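(* Let $m$ be an even positive integer not divisible by $3$ and let $a,d_1,d_2,d_3\in\mathbb{Z}/m\mathbb{Z}$ be such that $\gcd(d_1,m)=\gcd(d_3-d_2,m)=2$ and $d_2$, $d_3$, $d_2-d_1$, $d_1-d_3$ are invertible. Then the arithmetic tetrahedron $\mathrm{AS}(a,(d_1,d_2,d_3),s)$ is balanced for all positive integers $s\equiv 0$ or $-2\pmod m$.
   Context: $\mathrm{AS}(a,(d_1,d_2,d_3),s)=\{a+i_1d_1+i_2d_2+i_3d_3: i\in\mathbb{N}^3,\ i_1+i_2+i_3\le s-1\}$ as a multiset of $\mathbb{Z}/m\mathbb{Z}$. A multiset is balanced if every element of $\mathbb{Z}/m\mathbb{Z}$ occurs in it with the same multiplicity. For $x\in\mathbb{Z}/m\mathbb{Z}$, $\gcd(x,m)$ is the gcd of $m$ and any representative of $x$. *)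

(* Defs.v *)
From mathcomp Require Import all_boot all_order all_algebra.
From mathcomp Require Import finmap multiset.

Set Implicit Arguments.
Unset Strict Implicit.
Unset Printing Implicit Defensive.

Import GRing.Theory.
Local Open Scope ring_scope.

(* 'Z_m is Z/mZ only for 1 < m. *)

(* The constraint i1 + i2 + i3 <= s - 1 (s - 1 taken in Z, so that nothing
   satisfies it when s = 0) forces each i_j < s: the index set, a subset of
   N^3, is enumerated inside 'I_s * 'I_s * 'I_s. *)
Definition AS (m : nat) (a : 'Z_m) (d : 'Z_m * 'Z_m * 'Z_m) (s : nat) :
    {mset 'Z_m}%mset :=
  let: (d1, d2, d3) := d in
  seq_mset [seq a + d1 *+ i.1.1 + d2 *+ i.1.2 + d3 *+ i.2
             | i : 'I_s * 'I_s * 'I_s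
               in [pred i : 'I_s * 'I_s * 'I_s |
                    (i.1.1 + i.1.2 + i.2 < s)%N]].

Definition balanced (m : nat) (M : {mset 'Z_m}%mset) : Prop :=
  forall x y : 'Z_m, M x = M y.

(* Computed on the representative of x in [0, m). *)
Definition gcdZ (m : nat) (x : 'Z_m) : nat := gcdn x m.

(* Main.v *)
Require Import Defs.
From mathcomp Require Import all_boot all_order all_algebra all_field.
From mathcomp Require Import finmap multiset.
From mathcomp Require Import ring.

Import GRing.Theory.
Local Open Scope ring_scope.

(** By Fourier inversion on Z/mZ it suffices that the sum of [w ^+ u] over the
    tetrahedron vanishes for every m-th root of unity [w != 1]. Up to a unit,
    this sum is the complete homogeneous symmetric polynomial of degree [s - 1]
    in [1], [x], [y], [t], the values of the character at [0], [d1], [d2], [d3].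
    If [w != -1] these are pairwise distinct, and since [s = 0] or
    [s = -2 mod m], the Lagrange formula expresses the sum as the divided
    difference at four points of a monomial of degree [2] or [0], which is zero.
    If [w = -1] they are [1, 1, -1, -1], and the sum is the coefficient of
    degree [s - 1], an odd number, in [1 / (1 - T^2)^2]. *)

(** * Complete homogeneous sums built by convolution *)

Section GeometricConvolution.

Variable F : fieldType.
Implicit Types (x y t : F) (n s : nat).

Lemma sub_neq0_sym x y : x != y -> (x - y != 0) && (y - x != 0).
Proof. by rewrite !subr_eq0 [y == x]eq_sym => ->. Qed.

(** When [f n] is a complete homogeneous polynomial of degree [n - 1], with value 0 at [n = 0], this
    adjoins the variable [x]. *)
Definition geom_conv x (f : nat -> F) n : F :=
  \sum_(i < n) x ^+ i * f (n - i)%N.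

Lemma geom_conv0 x f : geom_conv x f 0 = 0.
Proof. by rewrite /geom_conv big_ord0. Qed.

Lemma geom_convS x f n : geom_conv x f n.+1 = f n.+1 + x * geom_conv x f n.
Proof.
rewrite /geom_conv big_ord_recl expr0 mul1r subn0 mulr_sumr; congr (_ + _).
by apply: eq_bigr => i _; rewrite lift0 subSS exprS mulrA.
Qed.

(** As subtraction on [nat] is truncated, every term with [n <= i] carries the factor [f 0]. *)
Lemma geom_conv_widen x f n s : (n <= s)%N -> f 0%N = 0 ->
  \sum_(i < s) x ^+ i * f (n - i)%N = geom_conv x f n.
Proof.
move=> le_ns f0; rewrite /geom_conv.
rewrite [RHS](big_ord_widen s (fun i => x ^+ i * f (n - i)%N)) // [RHS]big_mkcond.
apply: eq_bigr => i _; case: ltnP => // le_ni.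
by rewrite (eqP le_ni) f0 mulr0.
Qed.

Definition geom_sum t n : F := geom_conv t (fun=> 1) n.

(** The constant sequence 1 does not vanish at 0, so here the bound on [i] has to stay as a
    condition. *)
Lemma geom_sum_bounded t n s : (n <= s)%N ->
  \sum_(i < s | (i < n)%N) t ^+ i = geom_sum t n.
Proof.
move=> le_ns; rewrite /geom_sum /geom_conv -(big_ord_widen s (fun i => t ^+ i)) //.
by apply: eq_bigr => i _; rewrite mulr1.
Qed.

Definition tetra_sum x y t n : F :=
  geom_conv x (geom_conv y (geom_sum t)) n.

Lemma tetra_sumE x y t s :
  \sum_(i : 'I_s * 'I_s * 'I_s | (i.1.1 + i.1.2 + i.2 < s)%N)
     x ^+ i.1.1 * (y ^+ i.1.2 * t ^+ i.2) = tetra_sum x y t s.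
Proof.
rewrite /tetra_sum -(geom_conv_widen x _ s s) ?geom_conv0 //.
rewrite -(pair_big_dep xpredT
  (fun (p : 'I_s * 'I_s) (k : 'I_s) => (p.1 + p.2 + k < s)%N)
  (fun p k => x ^+ p.1 * (y ^+ p.2 * t ^+ k))) /=.
rewrite -(pair_bigA _ (fun i j : 'I_s => \sum_(k < s | (i + j + k < s)%N)
   x ^+ i * (y ^+ j * t ^+ k))) /=.
apply: eq_bigr => i _.
rewrite -(geom_conv_widen y _ _ s) ?leq_subr ?/geom_sum ?geom_conv0 // mulr_sumr.
apply: eq_bigr => j _.
rewrite -subnDA -/(geom_sum _ _) -(geom_sum_bounded _ _ s) ?leq_subr //.
rewrite !mulr_sumr; apply: eq_bigl => k.
by rewrite ltn_subRL.
Qed.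

Lemma geom_sum_lagrange t n : t != 1 -> geom_sum t n = (1 - t ^+ n) / (1 - t).
Proof.
rewrite eq_sym -subr_eq0 => t1; rewrite /geom_sum.
elim: n => [|n IHn]; first by rewrite geom_conv0 expr0 subrr mul0r.
by rewrite geom_convS IHn exprS; field.
Qed.

Lemma geom_conv_lagrange y t n : y != 1 -> t != 1 -> y != t ->
  geom_conv y (geom_sum t) n =
    ((1 - y) * (1 - t))^-1 + y ^+ n.+1 / ((y - 1) * (y - t))
    + t ^+ n.+1 / ((t - 1) * (t - y)).
Proof.
move=> y1 t1 yt.
have /andP[t1' t1''] := sub_neq0_sym _ _ t1.
have /andP[y1' y1''] := sub_neq0_sym _ _ y1.
have /andP[yt' yt''] := sub_neq0_sym _ _ yt.
elim: n => [|n IHn].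
  by rewrite geom_conv0 !expr1; field; do ?[apply/andP; split].
rewrite geom_convS IHn geom_sum_lagrange // !exprS.
by field; do ?[apply/andP; split].
Qed.

(** The right-hand side is the divided difference of [T ^+ n.+2] at [1], [x], [y], [t]; it vanishes
    at [n = 0] and satisfies the recurrence [geom_convS]. *)
Lemma tetra_sum_lagrange x y t n :
  x != 1 -> y != 1 -> t != 1 -> x != y -> x != t -> y != t ->
  tetra_sum x y t n =
    ((1 - x) * (1 - y) * (1 - t))^-1
    + x ^+ n.+2 / ((x - 1) * (x - y) * (x - t))
    + y ^+ n.+2 / ((y - 1) * (y - x) * (y - t))
    + t ^+ n.+2 / ((t - 1) * (t - x) * (t - y)).
Proof.
move=> x1 y1 t1 xy xt yt.
have /andP[x1' x1''] := sub_neq0_sym _ _ x1.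
have /andP[t1' t1''] := sub_neq0_sym _ _ t1.
have /andP[y1' y1''] := sub_neq0_sym _ _ y1.
have /andP[yt' yt''] := sub_neq0_sym _ _ yt.
have /andP[xt' xt''] := sub_neq0_sym _ _ xt.
have /andP[xy' xy''] := sub_neq0_sym _ _ xy.
rewrite /tetra_sum; elim: n => [|n IHn].
  by rewrite geom_conv0; field; do ?[apply/andP; split].
rewrite geom_convS IHn geom_conv_lagrange // !exprS.
by field; do ?[apply/andP; split].
Qed.

Lemma tetra_sum_eq0 x y t n :
  x != 1 -> y != 1 -> t != 1 -> x != y -> x != t -> y != t ->
  [/\ x ^+ n = 1, y ^+ n = 1 & t ^+ n = 1] \/
  [/\ x ^+ n.+2 = 1, y ^+ n.+2 = 1 & t ^+ n.+2 = 1] ->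
  tetra_sum x y t n = 0.
Proof.
move=> x1 y1 t1 xy xt yt roots; rewrite tetra_sum_lagrange //.
have /andP[x1' x1''] := sub_neq0_sym _ _ x1.
have /andP[t1' t1''] := sub_neq0_sym _ _ t1.
have /andP[y1' y1''] := sub_neq0_sym _ _ y1.
have /andP[yt' yt''] := sub_neq0_sym _ _ yt.
have /andP[xt' xt''] := sub_neq0_sym _ _ xt.
have /andP[xy' xy''] := sub_neq0_sym _ _ xy.
case: roots => -[]; last first.
  (* At the nodes the monomial takes the values of [1] here, and those of [T ^+ 2] in the case
     below. *)
  by move=> -> -> ->; field; do ?[apply/andP; split].
rewrite !exprS => -> -> ->.
by field; do ?[apply/andP; split].
Qed.

(** * Values at the nodes 1 and -1 *)

Lemma geom_sumN1 k : geom_sum (-1) k.*2 = 0 /\ geom_sum (-1) k.*2.+1 = 1.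
Proof.
rewrite /geom_sum; elim: k => [|k [IH0 IH1]].
  by rewrite geom_convS geom_conv0 mulr0 addr0.
by rewrite doubleS !geom_convS IH0; split; ring.
Qed.

(** These are the coefficients of (1 - T) / (1 - T^2)^2, in degree one less than the index. *)
Lemma geom_conv_geom_sumN1 k :
  geom_conv (-1) (geom_sum (-1)) k.*2 = - k%:R /\
  geom_conv (-1) (geom_sum (-1)) k.*2.+1 = k.+1%:R.
Proof.
elim: k => [|k [IH0 IH1]].
  by rewrite geom_convS geom_conv0 mulr0 addr0 oppr0 (geom_sumN1 0).2.
have [e0 e1] := geom_sumN1 k.+1.
rewrite doubleS in e0 e1 *.
rewrite [geom_conv _ _ _.+3]geom_convS [geom_conv _ _ _.+2]geom_convS.
by rewrite e0 e1 IH1 -!natr1; split; ring.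
Qed.

Lemma tetra_sum_N1 k : tetra_sum 1 (-1) (-1) k.*2 = 0.
Proof.
rewrite /tetra_sum; elim: k => [|k IHk]; first by rewrite geom_conv0.
have [_ e1] := geom_conv_geom_sumN1 k.
have [e2 _] := geom_conv_geom_sumN1 k.+1.
rewrite doubleS in e2 *.
(* Two steps of the recurrence add [k.+1] and then [- k.+1]. *)
by rewrite 2!(geom_convS 1) IHk e1 e2; ring.
Qed.

End GeometricConvolution.

(** * Characters of Z/mZ from roots of unity *)

Section RootCharacters.

Variables (m : nat) (m_gt1 : (1 < m)%N).
Implicit Types (u v d : 'Z_m) (w : algC).

(** Exponents are representatives in [0, m), and [w ^+ m = 1] absorbs the reduction mod [m]. *)
Lemma expr_ZpD w u v : w ^+ m = 1 -> w ^+ (u + v)%R = w ^+ u * w ^+ v.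
Proof.
by move=> wm; rewrite -exprD /= [X in (_ %% X)%N]Zp_cast // expr_mod.
Qed.

Lemma expr_ZpM w u v : w ^+ m = 1 -> w ^+ (u * v)%R = (w ^+ u) ^+ v.
Proof.
by move=> wm; rewrite -exprM /= [X in (_ %% X)%N]Zp_cast // expr_mod.
Qed.

Lemma expr_Zp_muln w u n : w ^+ m = 1 -> w ^+ (u *+ n)%R = (w ^+ u) ^+ n.
Proof.
by move=> wm; elim: n => // n IHn; rewrite mulrS expr_ZpD // IHn exprS.
Qed.

(** Raising [w ^+ d] to the power [d^-1] gives back [w]. *)
Lemma expr_Zp_unit w d : w ^+ m = 1 -> w != 1 -> d \is a GRing.unit ->
  w ^+ d != 1.
Proof.
move=> wm w1 dU; apply: contra w1 => /eqP wd.
have := expr_ZpM w d d^-1 wm; rewrite wd expr1n divrr //.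
by rewrite /= Zp_cast // modn_small // expr1 => ->.
Qed.

Lemma expr_Zp_neq w u v : w ^+ m = 1 -> w ^+ (u - v)%R != 1 -> w ^+ u != w ^+ v.
Proof.
move=> wm; apply: contra => /eqP uv.
(* Cancelling [w ^+ v] is allowed: if it were 0, its [m]-th power could not be 1. *)
have v0 : w ^+ v != 0.
  apply: contraTneq (oner_neq0 algC) => v0.
  have wvm : (w ^+ v) ^+ m = 1 by rewrite exprAC wm expr1n.
  by rewrite -wvm v0 expr0n eqn0Ngt (ltnW m_gt1) eqxx.
by apply/eqP/(mulIf v0); rewrite -expr_ZpD // subrK mul1r.
Qed.

(** Bezout: a multiple of [m] equals a multiple of [d] plus the gcd. *)
Lemma expr_Zp_gcd w d : w ^+ m = 1 -> w ^+ d = 1 -> w ^+ gcdZ d = 1.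
Proof.
move=> wm wd; rewrite /gcdZ gcdnC.
have [k l def_k _] := egcdnP d (ltnW m_gt1).
have : w ^+ (k * m) = 1 by rewrite mulnC exprM wm expr1n.
by rewrite def_k exprD mulnC exprM wd expr1n mul1r.
Qed.

Lemma sum_unity_root_powers w : w ^+ m = 1 ->
  \sum_(k < m) w ^+ k = if w == 1 then m%:R else 0.
Proof.
move=> wm; case: eqP => [-> | /eqP w1].
  by under eq_bigr do rewrite expr1n; rewrite sumr_const card_ord.
have := subrX1 w m; rewrite wm subrr => /esym/eqP.
by rewrite mulf_eq0 subr_eq0 (negPf w1) => /eqP.
Qed.

(** The double sum [S] is computed in two ways: summing over [k] first leaves [m] for each [u = v],
    by orthogonality, while summing over [u] first leaves only the trivial character [k = 0], which
    counts [L]. *)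
Lemma count_fourier (L : seq 'Z_m) :
  (forall w, w ^+ m = 1 -> w != 1 -> \sum_(u <- L) w ^+ u = 0) ->
  forall v, (m * count_mem v L)%N = size L.
Proof.
move=> L0 v; have [z prim_z] := C_prim_root_exists (ltnW m_gt1).
have zm := prim_expr_order prim_z.
have zkm k : (z ^+ k) ^+ m = 1 by rewrite exprAC zm expr1n.
apply/eqP; rewrite -(Num.Theory.eqr_nat algC); apply/eqP.
pose S := \sum_(k < m) \sum_(u <- L) (z ^+ k) ^+ (u - v)%R.
transitivity S.
  rewrite /S exchange_big /= -sum1_count mulnC natrM natr_sum mulr_suml.
  rewrite big_mkcond; apply: eq_bigr => u _ /=.
  rewrite (eq_bigr (fun k : 'I_m => (z ^+ (u - v)%R) ^+ k)); last first.
    by move=> k _; rewrite exprAC.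
  rewrite sum_unity_root_powers ?zkm // -(prim_order_dvd prim_z).
  rewrite -subr_eq0 mul1r /dvdn modn_small //.
  by have := ltn_ord (u - v); rewrite [X in (_ < X)%N]Zp_cast.
have m_gt0 := ltnW m_gt1.
have nontrivial (k : 'I_m) : k != Ordinal m_gt0 ->
    \sum_(u <- L) (z ^+ k) ^+ (u - v)%R = 0.
  move=> k0; under eq_bigr do rewrite expr_ZpD ?zkm //.
  by rewrite -mulr_suml L0 ?mul0r // -(prim_order_dvd prim_z) /dvdn modn_small.
rewrite /S (bigD1 (Ordinal m_gt0)) // (big1 _ _ _ nontrivial) /= addr0.
under eq_bigr do rewrite expr1n.
by rewrite big_const_seq count_predT iter_addr_0.
Qed.

End RootCharacters.

(** * Evaluation of the characters on the tetrahedron *)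

Theorem theorem3p15 (m : nat) (m_gt0 : (0 < m)%N) (m_even : (2 %| m)%N)
    (m_n3 : ~~ (3 %| m)%N) (a d1 d2 d3 : 'Z_m)
    (gcd_d1 : gcdZ d1 = 2%N) (gcd_d32 : gcdZ (d3 - d2) = 2%N)
    (unit_d2 : d2 \is a GRing.unit) (unit_d3 : d3 \is a GRing.unit)
    (unit_d21 : d2 - d1 \is a GRing.unit)
    (unit_d13 : d1 - d3 \is a GRing.unit)
    (s : nat) (s_gt0 : (0 < s)%N)
    (s_mod : (s%:Z = 0 %[mod m%:Z])%Z \/ (s%:Z = - 2 %[mod m%:Z])%Z) :
  balanced (AS a (d1, d2, d3) s).
Proof.
have m_gt1 : (1 < m)%N by apply: dvdn_leq.
have s_dvd : (m %| s)%N \/ (m %| s.+2)%N.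
  case: s_mod => /eqP; rewrite eqz_mod_dvd ?subr0 ?opprK; [by left | right].
  by rewrite -addn2.
(* As [m] is even, so is [s] in both cases; this makes the degree [s - 1] odd when [w = -1]. *)
have s_even : ~~ odd s.
  rewrite -dvdn2; case: s_dvd => /(dvdn_trans m_even) //.
rewrite /balanced /AS => u v; rewrite !mset_seqE.
set L := [seq _ | i in _].
suff L0 (w : algC) : w ^+ m = 1 -> w != 1 -> \sum_(x <- L) w ^+ x = 0.
  apply/eqP; rewrite -(eqn_pmul2l m_gt0).
  by rewrite !(count_fourier m m_gt1 L L0).
move=> wm w1; rewrite big_image.
pose x := w ^+ d1; pose y := w ^+ d2; pose t := w ^+ d3.
(* Translation by [a] only contributes a factor. *)
transitivity (w ^+ a * tetra_sum _ x y t s).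
  rewrite -tetra_sumE mulr_sumr; apply: eq_big => // i _.
  by rewrite !expr_ZpD // !expr_Zp_muln // !mulrA.
suff -> : tetra_sum _ x y t s = 0 by rewrite mulr0.
have unit_neq1 (d : 'Z_m) : d \is a GRing.unit -> w ^+ d != 1.
  exact: expr_Zp_unit.
have y1 : y != 1 := unit_neq1 _ unit_d2.
have t1 : t != 1 := unit_neq1 _ unit_d3.
have sqr_N1 (r : algC) : r ^+ 2 = 1 -> r != 1 -> r = -1.
  by move=> /eqP; rewrite sqrf_eq1 => /orP[] /eqP // ->; rewrite eqxx.
have [wN1 | wN1] := eqVneq (w ^+ 2) 1.
  (* Here [w = -1]: the even [d1] gives 1, and the units [d2], [d3] give square roots of 1 other
     than 1. *)
  have -> : x = 1.
    rewrite /x; have : (2 %| d1)%N by rewrite -gcd_d1 dvdn_gcdl.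
    by case/dvdnP=> k ->; rewrite mulnC exprM wN1 expr1n.
  have pow_N1 (d : 'Z_m) : w ^+ d != 1 -> w ^+ d = -1.
    by apply: sqr_N1; rewrite exprAC wN1 expr1n.
  have -> : y = -1 := pow_N1 d2 y1.
  have -> : t = -1 := pow_N1 d3 t1.
  rewrite -(even_halfK s_even).
  exact: tetra_sum_N1.
(* An element [d] of gcd 2 has [w ^+ d = 1] only if [w ^+ 2 = 1], so here [d1] and [d3 - d2]
   separate nodes as units do. *)
have gcd_neq1 (d : 'Z_m) : gcdZ d = 2%N -> w ^+ d != 1.
  move=> d_gcd; apply: contra wN1 => /eqP /(expr_Zp_gcd m m_gt1 w d wm).
  by rewrite d_gcd => ->.
have root_dvd n (d : 'Z_m) : (m %| n)%N -> (w ^+ d) ^+ n = 1.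
  by case/dvdnP=> k ->; rewrite exprAC mulnC exprM wm !expr1n.
apply: tetra_sum_eq0 => //.
- exact: gcd_neq1.
- by rewrite eq_sym; apply: expr_Zp_neq => //; apply: unit_neq1.
- by apply: expr_Zp_neq => //; apply: unit_neq1.
- by rewrite eq_sym; apply: expr_Zp_neq => //; apply: gcd_neq1.
by case: s_dvd => /root_dvd E; [left | right]; split; apply: E.
Qed.
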